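(* Let $\mathfrak g$ be a Lie algebra endowed with an LCS structure $(\omega',\theta')$ and let $\mathfrak u\neq\{0\}$ be an ideal of $\mathfrak g$ which is non-degenerate, i.e. the restriction $\omega'|_{\mathfrak u}$ is non-degenerate. Let $\mathfrak u^\perp=\{X\in\mathfrak g:\omega'(X,U)=0\ \text{for all } U\in\mathfrak u\}$, so that $\mathfrak g=\mathfrak u^\perp\oplus\mathfrak u$ as vector spaces. (i) If $\mathfrak u\subset\ker\theta'$, then $\mathfrak u^\perp$ is a subalgebra of $\mathfrak g$. (ii) If, moreover, $\mathfrak u$ is abelian, then (with $\mathfrak u^\perp$ endowed with the LCS structure $(\omega'|_{\mathfrak u^\perp},\theta'|_{\mathfrak u^\perp})$ and $\mathfrak u$ with the symplectic form $\omega'|_{\mathfrak u}$) the map $\operatorname{ad}:\mathfrak u^\perp\to\operatorname{End}(\mathfrak u)$, $X\mapsto\operatorname{ad}_X|_{\mathfrak u}$, is an LCS representation, and $(\mathfrak g,\omega',\theta')$ is isomorphic to $(\mathfrak u^\perp\ltimes_{\operatorname{ad}}\mathfrak u,\tilde\omega,\tilde\theta)$, where $\tilde\omega|_{\mathfrak u^\perp}=\omega'|_{\mathfrak u^\perp}$, $\tilde\omega|_{\mathfrak u}=\omega'|_{\mathfrak u}$, $\tilde\omega(\mathfrak u^\perp,\mathfrak u)=0$, $\tilde\theta|_{\mathfrak u^\perp}=\theta'|_{\mathfrak u^\perp}$ and $\tilde\theta|_{\mathfrak u}=0$. In particular, $(\omega',\theta')$ is an LCS structure of the second kind.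
   Context: Lie algebras are real and finite-dimensional. An LCS (locally conformal symplectic) structure on a Lie algebra $\mathfrak g$ is a pair $(\omega,\theta)$ with $\omega\in\bigwedge^2\mathfrak g^*$ non-degenerate, $\theta\in\mathfrak g^*$ closed (i.e. vanishing on $[\mathfrak g,\mathfrak g]$), and $d\omega=\theta\wedge\omega$, where $d\omega(X,Y,Z)=-\omega([X,Y],Z)-\omega([Y,Z],X)-\omega([Z,X],Y)$ and $(\theta\wedge\omega)(X,Y,Z)=\theta(X)\omega(Y,Z)+\theta(Y)\omega(Z,X)+\theta(Z)\omega(X,Y)$. Put $\mathfrak g_\omega=\{X\in\mathfrak g:\omega([X,Y],Z)+\omega(Y,[X,Z])=0\ \text{for all } Y,Z\in\mathfrak g\}$. The LCS structure is of the second kind if $\theta|_{\mathfrak g_\omega}$ is identically zero (and of the first kind otherwise). Given a Lie algebra $\mathfrak h$ with LCS structure $(\omega,\theta)$ and a symplectic vector space $(V,\omega_0)$, a representation $\pi:\mathfrak h\to\operatorname{End}(V)$ is an LCS representation if for all $X\in\mathfrak h$, $\pi(X)=-\frac12\theta(X)\operatorname{Id}+\rho(X)$ with $\rho(X)\in\mathfrak{sp}(V,\omega_0)$, i.e. $\omega_0(\rho(X)Y,Z)=-\omega_0(Y,\rho(X)Z)$ for all $Y,Z\in V$. The semidirect product $\mathfrak h\ltimes_\pi V$ is $\mathfrak h\oplus V$ with the bracket of $\mathfrak h$ on $\mathfrak h$, $V$ an abelian ideal, and $[X,Y]=\pi(X)Y$ for $X\in\mathfrak h$, $Y\in V$. An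 isomorphism of LCS Lie algebras is a Lie algebra isomorphism that pulls back the $2$-form to the $2$-form and the Lee form to the Lee form. *)

(* Defs.v *)
From HB Require Import structures.
From mathcomp Require Import all_boot all_order all_algebra.
From mathcomp Require Import reals.

Set Implicit Arguments.
Unset Strict Implicit.
Unset Printing Implicit Defensive.

Import GRing.Theory.
Local Open Scope ring_scope.

HB.mixin Record isLieAlgebra (R : realType) L of Vector R L := {
  lie : L -> L -> L;
  lie_linearl : forall Y, linear (lie^~ Y);
  lie_linearr : forall X, linear (lie X);
  liexx : forall X, lie X X = 0;
  lie_jacobi : forall X Y Z,
    lie X (lie Y Z) + lie Y (lie Z X) + lie Z (lie X Y) = 0 }.

#[short(type="lieAlgType")]
HB.structure Definition LieAlgebra (R : realType) :=
  { L of isLieAlgebra R L & Vector R L }.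

Section Forms.
Context {R : realType}.

Record is_two_form (V : vectType R) (om : V -> V -> R) : Prop := IsTwoForm {
  two_form_linearl : forall Y, scalar (om^~ Y);
  two_form_linearr : forall X, scalar (om X);
  two_formxx : forall X, om X X = 0 }.

Definition nondegenerate_form (V : vectType R) (om : V -> V -> R) : Prop :=
  forall X, (forall Y, om X Y = 0) -> X = 0.

Record is_symplectic_form (V : vectType R) (om : V -> V -> R) : Prop :=
  IsSymplecticForm {
    symplectic_two_form : is_two_form om;
    symplectic_nondeg : nondegenerate_form om }.

Definition in_sp (V : vectType R) (om : V -> V -> R) (A : 'End(V)) : Prop :=
  forall Y Z, om (A Y) Z = - om Y (A Z).

Definition restr1 (V : vectType R) (th : V -> R) (U : {vspace V})
    (X : subvs_of U) : R := th (vsval X).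

Definition restr2 (V : vectType R) (om : V -> V -> R) (U : {vspace V})
    (X Y : subvs_of U) : R := om (vsval X) (vsval Y).

#[global] Arguments restr1 {V} th U X.
#[global] Arguments restr2 {V} om U X Y.

(* [linfun] is meaningful only for linear arguments, hence the bilinearity
   hypothesis of [mem_perp]. *)
Definition perp (V : vectType R) (om : V -> V -> R) (U : {vspace V}) :
    {vspace V} :=
  (\bigcap_(W <- vbasis U) lker (linfun (om^~ W : V -> R^o)))%VS.

Lemma mem_perp (V : vectType R) (om : V -> V -> R) (U : {vspace V}) (X : V) :
  is_two_form om ->
  reflect (forall W, W \in U -> om X W = 0) (X \in perp om U).
Proof.
move=> hom.
have memE : (X \in perp om U) = all (fun W => om X W == 0) (vbasis U).
  rewrite /perp; elim: (tval (vbasis U)) => [|W s IHs].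
    by rewrite big_nil memvf.
  rewrite big_cons memv_cap IHs /= memv_ker; congr (_ && _).
  pose f : {linear V -> R^o} :=
    HB.pack (om^~ W : V -> R^o)
      (GRing.isLinear.Build R V R^o *:%R _ (two_form_linearl hom W)).
  by rewrite -[linfun _]/(linfun f) lfunE.
pose g : {linear V -> R^o} :=
  HB.pack (om X : V -> R^o)
    (GRing.isLinear.Build R V R^o *:%R _ (two_form_linearr hom X)).
rewrite memE; apply: (iffP allP) => [h W WU | h W WU]; last first.
  by apply/eqP/h/vbasis_mem.
rewrite (coord_vbasis WU).
suff: g (\sum_i coord (vbasis U) i W *: (vbasis U)`_i) = 0 by [].
rewrite linear_sum big1 // => i _; rewrite linearZ_LR.
have /h/eqP gi0 : (vbasis U)`_i \in vbasis U by rewrite mem_nth // size_tuple.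
by rewrite [g _]gi0 scaler0.
Qed.

End Forms.

Section LCS.
Context {R : realType}.

Definition d_form (L : lieAlgType R) (om : L -> L -> R) (X Y Z : L) : R :=
  - om (lie X Y) Z - om (lie Y Z) X - om (lie Z X) Y.

Definition wedge12 (L : lieAlgType R) (th : L -> R) (om : L -> L -> R)
    (X Y Z : L) : R :=
  th X * om Y Z + th Y * om Z X + th Z * om X Y.

Record is_lcs (L : lieAlgType R) (om : L -> L -> R) (th : L -> R) : Prop :=
  IsLCS {
    lcs_form : is_two_form om;
    lcs_nondeg : nondegenerate_form om;
    lee_scalar : scalar th;
    lee_closed : forall X Y, th (lie X Y) = 0;
    lcs_d : forall X Y Z, d_form om X Y Z = wedge12 th om X Y Z }.

Definition stabilizes_form (L : lieAlgType R) (om : L -> L -> R) (X : L) :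
    Prop :=
  forall Y Z, om (lie X Y) Z + om Y (lie X Z) = 0.

Definition second_kind (L : lieAlgType R) (om : L -> L -> R) (th : L -> R) :
    Prop :=
  is_lcs om th /\ forall X, stabilizes_form om X -> th X = 0.

Definition lcs_isomorphic (L1 L2 : lieAlgType R)
    (om1 : L1 -> L1 -> R) (th1 : L1 -> R)
    (om2 : L2 -> L2 -> R) (th2 : L2 -> R) : Prop :=
  exists f : 'Hom(L1, L2),
    [/\ bijective f,
        forall X Y, f (lie X Y) = lie (f X) (f Y),
        forall X Y, om2 (f X) (f Y) = om1 X Y &
        forall X, th2 (f X) = th1 X].

Definition is_subalgebra (L : lieAlgType R) (H : {vspace L}) : Prop :=
  forall X Y, X \in H -> Y \in H -> lie X Y \in H.

Definition is_ideal (L : lieAlgType R) (U : {vspace L}) : Prop :=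
  forall X Y, Y \in U -> lie X Y \in U.

Definition is_abelian (L : lieAlgType R) (U : {vspace L}) : Prop :=
  forall X Y, X \in U -> Y \in U -> lie X Y = 0.

Record is_representation (L : lieAlgType R) (V : vectType R)
    (pi : L -> 'End(V)) : Prop := IsRepresentation {
  rep_linear : linear pi;
  rep_lie : forall X Y, pi (lie X Y) = (pi X \o pi Y)%VF - (pi Y \o pi X)%VF }.

Definition is_lcs_representation (L : lieAlgType R) (V : vectType R)
    (th : L -> R) (om0 : V -> V -> R) (pi : L -> 'End(V)) : Prop :=
  is_representation pi /\
  forall X, exists rho : 'End(V),
    in_sp om0 rho /\ pi X = (- (2^-1 * th X)) *: \1%VF + rho.

End LCS.

Section Subalgebra.
Context {R : realType} (L : lieAlgType R) (H : {vspace L}).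

Definition subalg_of (hH : is_subalgebra H) : Type := subvs_of H.

Variable hH : is_subalgebra H.

HB.instance Definition _ := Vector.on (subalg_of hH).

Definition subalg_lie (X Y : subalg_of hH) : subalg_of hH :=
  Subvs (hH (subvsP X) (subvsP Y)).

Fact subalg_lie_linearl Y : linear (subalg_lie^~ Y).
Proof. by move=> a X Z; apply: val_inj; exact: lie_linearl. Qed.

Fact subalg_lie_linearr X : linear (subalg_lie X).
Proof. by move=> a Y Z; apply: val_inj; exact: lie_linearr. Qed.

Fact subalg_liexx X : subalg_lie X X = 0.
Proof. by apply: val_inj; exact: liexx. Qed.

Fact subalg_lie_jacobi X Y Z :
  subalg_lie X (subalg_lie Y Z) + subalg_lie Y (subalg_lie Z X)
    + subalg_lie Z (subalg_lie X Y) = 0.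
Proof. by apply: val_inj; exact: lie_jacobi. Qed.

HB.instance Definition _ := isLieAlgebra.Build R (subalg_of hH)
  subalg_lie_linearl subalg_lie_linearr subalg_liexx subalg_lie_jacobi.

(* [vsproj] is the identity on U; it is applied to elements of U as soon as
   [H, U] is contained in U, in particular when U is an ideal. *)
Definition ad_on (U : {vspace L}) (X : subalg_of hH) : 'End(subvs_of U) :=
  linfun (fun Y : subvs_of U => vsproj U (lie (vsval X) (vsval Y))).

End Subalgebra.

Arguments ad_on {R L H} hH U X.

Section Semidirect.
Context {R : realType} (L : lieAlgType R) (V : vectType R) (pi : L -> 'End(V)).

Definition semidirect (hpi : is_representation pi) : Type := (L * V)%type.

Variable hpi : is_representation pi.

HB.instance Definition _ := Vector.on (semidirect hpi).

Definition semidirect_lie (X Y : semidirect hpi) : semidirect hpi :=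
  (lie X.1 Y.1, pi X.1 Y.2 - pi Y.1 X.2).

Fact semidirect_lie_linearl Y : linear (semidirect_lie^~ Y).
Proof.
move=> a X Z; congr pair => /=; first exact: lie_linearl.
by rewrite (rep_linear hpi) linearP !lfunE /= lfunE scalerBr opprD addrACA.
Qed.

Fact semidirect_lie_linearr X : linear (semidirect_lie X).
Proof.
move=> a Y Z; congr pair => /=; first exact: lie_linearr.
by rewrite (rep_linear hpi) linearP !lfunE /= lfunE scalerBr opprD addrACA.
Qed.

Fact semidirect_liexx X : semidirect_lie X X = 0.
Proof. by congr pair; rewrite ?liexx ?subrr. Qed.

Let rep_lieE X Y v : pi (lie X Y) v = pi X (pi Y v) - pi Y (pi X v).
Proof. by rewrite (rep_lie hpi) !lfun_simp. Qed.

Fact semidirect_lie_jacobi X Y Z :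
  semidirect_lie X (semidirect_lie Y Z) + semidirect_lie Y (semidirect_lie Z X)
    + semidirect_lie Z (semidirect_lie X Y) = 0.
Proof.
congr pair => /=; first exact: lie_jacobi.
case: X Y Z => [x u] [y v] [z w] /=.
rewrite !rep_lieE !linearB /= !opprK.
rewrite (AC ((2*2)*(2*2)*(2*2))
  (((1*11)*(8*2))*((5*3)*(4*10))*((9*7)*(12*6)))) /=.
by rewrite !subrr !addr0.
Qed.

HB.instance Definition _ := isLieAlgebra.Build R (semidirect hpi)
  semidirect_lie_linearl semidirect_lie_linearr semidirect_liexx
  semidirect_lie_jacobi.

Definition semidirect_form (om : L -> L -> R) (om0 : V -> V -> R)
    (X Y : semidirect hpi) : R := om X.1 Y.1 + om0 X.2 Y.2.

Definition semidirect_lee (th : L -> R) (X : semidirect hpi) : R := th X.1.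

End Semidirect.

Arguments semidirect_form {R L V pi} hpi om om0 X Y.
Arguments semidirect_lee {R L V pi} hpi th X.

(* Main.v *)
Require Import Defs.
From HB Require Import structures.
From mathcomp Require Import all_boot all_order all_algebra.
From mathcomp Require Import reals.

Import GRing.Theory.
Local Open Scope ring_scope.

(** Everything comes from evaluating d om = th /\ om on triples that meet the
ideal U, where most terms vanish because U is an ideal inside the kernel of th.

On (X, Y, W) with X, Y orthogonal to U and W in U, the brackets [Y, W] and
[W, X] lie in U, so they are orthogonal to X and Y, and th W = 0: what is left
is om([X, Y], W) = 0, which says that the orthogonal of U is a subalgebra
([perp_subalgebra]).

On (X, Y, Z) with Y, Z in U and U abelian, what is left is
  om([X, Y], Z) + om(Y, [X, Z]) = - th(X) om(Y, Z)
([abelian_ideal_homothety]): ad_X acts on the symplectic space U as an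
infinitesimal homothety of ratio - th(X). Adding half of th(X) times the
identity brings it into the symplectic algebra, so ad is an LCS representation.
The same identity gives the second kind: it holds for every X of the whole
algebra, and if X stabilizes om its left-hand side is 0, so th(X) = 0 as soon
as om is nonzero on U.

The remaining part is linear algebra. Non-degeneracy on U splits the space as
the direct sum of U and its orthogonal ([addv_perp], [capv_perp]), and the sum
map (X, Y) |-> X + Y from the semidirect product is an isomorphism
([semidirect_isomorphic]). The LCS axioms of the semidirect product are then
transported through this isomorphism ([lcs_isomorphic_lcs]). *)

(** * Orthogonal complements for alternating forms *)

Section TwoForms.
Context {R : realType} {V : vectType R} {om : V -> V -> R}.
Context (hom : is_two_form om).

Lemma two_formDl X Y Z : om (X + Y) Z = om X Z + om Y Z.
Proof. by have := two_form_linearl hom Z 1 X Y; rewrite /= scale1r mul1r. Qed.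

Lemma two_form0l Z : om 0 Z = 0.
Proof. by apply: (addrI (om 0 Z)); rewrite -two_formDl !addr0. Qed.

Lemma two_formZl a X Z : om (a *: X) Z = a * om X Z.
Proof.
by have := two_form_linearl hom Z a X 0; rewrite /= two_form0l !addr0.
Qed.

Lemma two_formDr X Y Z : om X (Y + Z) = om X Y + om X Z.
Proof. by have := two_form_linearr hom X 1 Y Z; rewrite /= scale1r mul1r. Qed.

Lemma two_form_antisym X Y : om X Y = - om Y X.
Proof.
have := two_formxx hom (X + Y).
rewrite two_formDl !two_formDr !(two_formxx hom) addr0 add0r.
by move/eqP; rewrite addr_eq0 => /eqP.
Qed.

Lemma two_form0r X : om X 0 = 0.
Proof. by rewrite two_form_antisym two_form0l oppr0. Qed.

Lemma two_formZr a X Z : om X (a *: Z) = a * om X Z.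
Proof.
by rewrite two_form_antisym two_formZl (two_form_antisym Z) mulrN opprK.
Qed.

Lemma two_formNl X Y : om (- X) Y = - om X Y.
Proof. by rewrite -scaleN1r two_formZl mulN1r. Qed.

Lemma is_two_form_restr (U : {vspace V}) : is_two_form (restr2 om U).
Proof.
split=> [Y a X Z|X a Y Z|X]; rewrite /restr2.
- exact: (two_form_linearl hom).
- exact: (two_form_linearr hom).
- exact: (two_formxx hom).
Qed.

Context {U : {vspace V}} (hnd : nondegenerate_form (restr2 om U)).

Lemma nondegenerate_restr_eq0 X :
  X \in U -> (forall W, W \in U -> om X W = 0) -> X = 0.
Proof.
move=> XU h.
by have /(congr1 vsval) := hnd (Subvs XU) (fun W => h _ (subvsP W)).
Qed.

Lemma capv_perp : (perp om U :&: U)%VS = 0%VS.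
Proof.
apply/eqP; rewrite -subv0; apply/subvP => X; rewrite memv_cap memv0.
case/andP=> /(mem_perp _ _ hom) h XU.
by apply/eqP/nondegenerate_restr_eq0.
Qed.

(** The map T sending X to the coordinates of om X on a basis of U has
the orthogonal of U as kernel. It is thus injective on U, and comparing
dimensions already the image of U is everything: each X has the same image as
some Y in U, and X - Y is orthogonal to U. *)
Lemma addv_perp : (perp om U + U)%VS = fullv.
Proof.
pose T0 X : 'rV[R]_(\dim U) := \row_i om X (vbasis U)`_i.
have T0lin : linear T0.
  move=> a X Y; apply/rowP => i; rewrite !mxE.
  exact: (two_form_linearl hom).
pose Tl : {linear V -> 'rV[R]_(\dim U)} := HB.pack T0
  (GRing.isLinear.Build R V 'rV[R]_(\dim U) *:%R T0 T0lin).
pose T := linfun Tl.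
have TE X : T X = T0 X by rewrite lfunE.
have kerT : lker T = perp om U.
  apply/vspaceP => X; rewrite memv_ker TE.
  apply/eqP/(mem_perp _ _ hom) => [h W WU|h]; last first.
    by apply/rowP => i; rewrite !mxE h // vbasis_mem // mem_nth ?size_tuple.
  rewrite (coord_vbasis WU).
  elim/big_rec: _ => [|i s _ IHs]; first exact: two_form0r.
  rewrite two_formDr two_formZr IHs addr0.
  by have /rowP/(_ i) := h; rewrite !mxE => ->; rewrite mulr0.
have imT : (T @: U)%VS = fullv.
  apply/eqP; rewrite eqEdim subvf limg_dim_eq.
    by rewrite dimvf /dim /= mul1n.
  by rewrite kerT capvC capv_perp.
apply/eqP; rewrite eqEsubv subvf /=; apply/subvP => X _.
have /memv_imgP[Y YU TXY] : T X \in (T @: U)%VS by rewrite imT memvf.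
rewrite -(subrK Y X) memv_add // -kerT memv_ker linearB /= subr_eq0.
exact/eqP.
Qed.

(** A vector in the radical of the restriction to the orthogonal of U is
orthogonal to U as well, hence to the whole space. *)
Lemma nondegenerate_perp :
  nondegenerate_form om -> nondegenerate_form (restr2 om (perp om U)).
Proof.
move=> nd X h; apply: val_inj; apply: nd => Y /=.
have /memv_addP[Z ZP [W WU ->]] : Y \in (perp om U + U)%VS.
  by rewrite addv_perp memvf.
have /(mem_perp _ _ hom)/(_ W WU) XW := subvsP X.
rewrite two_formDr XW addr0.
exact: (h (Subvs ZP)).
Qed.

End TwoForms.

(** * Transport of structure along LCS isomorphisms *)

Section Isomorphisms.
Context {R : realType}.

Lemma lcs_isomorphic_sym {L1 L2 : lieAlgType R}
    {om1 : L1 -> L1 -> R} {th1 : L1 -> R}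
    {om2 : L2 -> L2 -> R} {th2 : L2 -> R} :
  lcs_isomorphic om1 th1 om2 th2 -> lcs_isomorphic om2 th2 om1 th1.
Proof.
case=> f [fbij fL fom fth]; exists (f^-1)%VF.
have kf : lker f == 0%VS by apply/lker0P; exact: bij_inj.
have fK : cancel f (f^-1)%VF := lker0_lfunK kf.
have fVK : cancel (f^-1)%VF f := (bij_can_sym fbij _).2 fK.
split=> [|X Y|X Y|X].
- by exists f.
- by apply: (bij_inj fbij); rewrite fL !fVK.
- by rewrite -fom !fVK.
- by rewrite -fth fVK.
Qed.

Lemma lcs_isomorphic_lcs {L1 L2 : lieAlgType R}
    {om1 : L1 -> L1 -> R} {th1 : L1 -> R}
    {om2 : L2 -> L2 -> R} {th2 : L2 -> R} :
  lcs_isomorphic om1 th1 om2 th2 -> is_lcs om2 th2 -> is_lcs om1 th1.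
Proof.
case=> f [[f' fK f'K] fL fom fth] [[oml omr omxx] nd thl thc d].
split; first split.
- by move=> Y a X Z; rewrite /= -!fom linearP; exact: oml.
- by move=> X a Y Z; rewrite /= -!fom linearP; exact: omr.
- by move=> X; rewrite -fom.
- move=> X h; apply: (can_inj fK); rewrite linear0; apply: nd => Y.
  by rewrite -(f'K Y) fom.
- by move=> a X Y; rewrite -!fth linearP; exact: thl.
- by move=> X Y; rewrite -fth fL.
- by move=> X Y Z; have := d (f X) (f Y) (f Z);
    rewrite /d_form /wedge12 -!fL !fom !fth.
Qed.

End Isomorphisms.

(** * Semidirect products and ideals with a complementary subalgebra *)

Section LieAlgebras.
Context {R : realType} {L : lieAlgType R}.
Implicit Types X Y Z : L.

Lemma lieDl X Y Z : lie (X + Y) Z = lie X Z + lie Y Z.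
Proof. by have := lie_linearl Z 1 X Y; rewrite /= !scale1r. Qed.

Lemma lieDr X Y Z : lie X (Y + Z) = lie X Y + lie X Z.
Proof. by have := lie_linearr X 1 Y Z; rewrite /= !scale1r. Qed.

Lemma lie_antisym X Y : lie X Y = - lie Y X.
Proof.
have := liexx (X + Y); rewrite lieDl !lieDr !liexx addr0 add0r.
by move/eqP; rewrite addr_eq0 => /eqP.
Qed.

Lemma lie0r X : lie X 0 = 0.
Proof. by apply: (addrI (lie X 0)); rewrite -lieDr !addr0. Qed.

Lemma lieNr X Y : lie X (- Y) = - lie X Y.
Proof.
by apply: (addrI (lie X Y)); rewrite -lieDr !subrr lie0r.
Qed.

(** The Jacobi identity, in the form saying that ad is a representation. *)
Lemma lie_derivation X Y Z :
  lie (lie X Y) Z = lie X (lie Y Z) - lie Y (lie X Z).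
Proof.
have := lie_jacobi X Y Z; move/eqP; rewrite addr_eq0 => /eqP J.
by rewrite lie_antisym -J (lie_antisym Z X) lieNr.
Qed.

Context {H U : {vspace L}} (hH : is_subalgebra H) (hU : is_ideal U).

(** Unfolds [ad_on] to the bracket: as U is an ideal, the projection in its
definition acts on an element of U, and [linfun] receives a linear map. *)
Lemma val_ad_on (X : subalg_of hH) (Y : subvs_of U) :
  vsval (ad_on hH U X Y) = lie (vsval X) (vsval Y).
Proof.
pose f0 (W : subvs_of U) := vsproj U (lie (vsval X) (vsval W)).
have f0lin : linear f0.
  move=> a W Z; rewrite /f0 linearP /=.
  by have -> := lie_linearr (vsval X) a (vsval W) (vsval Z); rewrite linearP.
pose f : {linear subvs_of U -> subvs_of U} := HB.pack f0
  (GRing.isLinear.Build R (subvs_of U) (subvs_of U) *:%R f0 f0lin).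
rewrite /ad_on -[linfun _]/(linfun f) lfunE /= /f0 vsprojK //.
exact/hU/subvsP.
Qed.

Lemma ad_on_representation : is_representation (ad_on hH U).
Proof.
split=> [a X Y|X Y]; apply/lfunP => W; apply: val_inj.
  rewrite !lfun_simp /= !val_ad_on linearP /=.
  exact: lie_linearl.
rewrite !lfun_simp linearB /= !val_ad_on.
exact: lie_derivation.
Qed.

Context (HU : (H + U)%VS = fullv) (HUd : directv (H + U)%VS).
Context (Uab : is_abelian U) (hpi : is_representation (ad_on hH U)).
Context {om : L -> L -> R} {th : L -> R}.
Context (hom : is_two_form om) (hth : scalar th).

(** The isomorphism is the sum map. It respects the bracket because
[x + v, y + w] = [x, y] + [x, w] - [y, v] + [v, w] and the last term vanishes
in the abelian ideal U; orthogonality of H and U and the vanishing of th on U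
take care of the two forms. *)
Lemma semidirect_isomorphic :
  (forall X Y, X \in H -> Y \in U -> om X Y = 0) ->
  (forall Y, Y \in U -> th Y = 0) ->
  lcs_isomorphic (semidirect_form hpi (restr2 om H) (restr2 om U))
    (semidirect_lee hpi (restr1 th H)) om th.
Proof.
move=> omHU thU.
pose f0 (z : semidirect hpi) : L := vsval z.1 + vsval z.2.
have f0lin : linear f0.
  move=> a [x v] [y w].
  rewrite -[f0 _]/(vsval (a *: x + y) + vsval (a *: v + w)).
  by rewrite !linearP /f0 /= scalerDr addrACA.
pose fl : {linear semidirect hpi -> L} := HB.pack f0
  (GRing.isLinear.Build R (semidirect hpi) L *:%R f0 f0lin).
have fE z : linfun fl z = vsval z.1 + vsval z.2 by rewrite lfunE.
exists (linfun fl); split.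
- have finj : injective (linfun fl).
    apply/lker0P; rewrite -subv0; apply/subvP => -[x y].
    rewrite memv_ker memv0 fE /= => /eqP xy0.
    have xU : vsval x \in U.
      by rewrite -[vsval x](addrK (vsval y)) xy0 sub0r memvN subvsP.
    move: HUd => /directv_addP/vspaceP/(_ (vsval x)).
    rewrite memv_cap subvsP xU memv0 => /esym/eqP x0.
    move: xy0; rewrite x0 add0r => y0.
    by apply/eqP; congr pair; apply: val_inj.
  have fsurj X : exists z, linfun fl z == X.
    have /memv_addP[Y YH [Z ZU ->]] : X \in (H + U)%VS by rewrite HU memvf.
    by exists ((Subvs YH : subalg_of hH), Subvs ZU); rewrite fE.
  exists (fun X => xchoose (fsurj X)) => [z|X].
    by apply: finj; exact/eqP/(xchooseP (fsurj _)).
  exact/eqP/(xchooseP (fsurj X)).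
- move=> [x v] [y w]; rewrite !fE /= !val_ad_on.
  rewrite lieDl !lieDr (Uab _ _ (subvsP v) (subvsP w)) addr0.
  by rewrite (lie_antisym (vsval v)) addrA.
- move=> [x v] [y w]; rewrite !fE /semidirect_form /restr2 /=.
  rewrite (two_formDl hom) !(two_formDr hom).
  rewrite (omHU _ _ (subvsP x) (subvsP w)) addr0.
  rewrite (two_form_antisym hom (vsval v) (vsval y)).
  by rewrite (omHU _ _ (subvsP y) (subvsP v)) oppr0 add0r.
- move=> [x v]; rewrite fE /semidirect_lee /restr1 /=.
  have := hth 1 (vsval x) (vsval v).
  by rewrite scale1r mul1r (thU _ (subvsP v)) addr0.
Qed.

End LieAlgebras.

(** * Ideals in the kernel of the Lee form *)

Section LCS.
Context {R : realType} {L : lieAlgType R} {om : L -> L -> R} {th : L -> R}.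
Context (hlcs : is_lcs om th).
Let hom := lcs_form hlcs.

Lemma is_lcs_restr (H : {vspace L}) (hH : is_subalgebra H) :
  nondegenerate_form (restr2 om H) ->
  is_lcs (restr2 om H : subalg_of hH -> subalg_of hH -> R) (restr1 th H).
Proof.
move=> nd; split=> //.
- exact: (is_two_form_restr hom).
- by move=> a X Y; exact: (lee_scalar hlcs).
- by move=> X Y; exact: (lee_closed hlcs).
- by move=> X Y Z; exact: (lcs_d hlcs).
Qed.

Context {U : {vspace L}} (hU : is_ideal U).
Context (thU : forall X, X \in U -> th X = 0).

(** For X, Y orthogonal to U and W in U, the term om([X, Y], W) is the only
one that survives in d om = th /\ om on (X, Y, W). *)
Lemma perp_subalgebra : is_subalgebra (perp om U).
Proof.
move=> X Y /(mem_perp _ _ hom) XU /(mem_perp _ _ hom) YU.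
apply/(mem_perp _ _ hom) => W WU.
have := lcs_d hlcs X Y W; rewrite /d_form /wedge12.
rewrite (thU _ WU) (YU W WU) (two_form_antisym hom W) (XU W WU).
rewrite (two_form_antisym hom (lie Y W)) (XU _ (hU _ _ WU)).
rewrite (lie_antisym W) (two_formNl hom) (two_form_antisym hom (lie X W)).
rewrite (YU _ (hU _ _ WU)) !oppr0 !mulr0 mul0r !addr0 => /eqP.
by rewrite oppr_eq0 => /eqP.
Qed.

Context (Uab : is_abelian U).

(** Evaluate d om = th /\ om on (X, Y, Z). As X need not lie in a complement of
U, the identity serves both for the LCS representation and for the second
kind. *)
Lemma abelian_ideal_homothety X Y Z : Y \in U -> Z \in U ->
  om (lie X Y) Z + om Y (lie X Z) = - (th X * om Y Z).
Proof.
move=> YU ZU.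
have := lcs_d hlcs X Y Z; rewrite /d_form /wedge12.
rewrite (Uab _ _ YU ZU) (two_form0l hom) (thU _ YU) (thU _ ZU).
rewrite !mul0r !addr0 => <-.
rewrite subr0 opprD !opprK (lie_antisym Z) (two_formNl hom).
by rewrite (two_form_antisym hom Y).
Qed.

Lemma ad_on_lcs_representation (H : {vspace L}) (hH : is_subalgebra H) :
  is_lcs_representation (restr1 th H : subalg_of hH -> R) (restr2 om U)
    (ad_on hH U).
Proof.
split=> [|X]; first exact: ad_on_representation.
(* The homothety of ratio - th X is split evenly between the two arguments of
   the form, whence the factor 1/2. *)
exists (ad_on hH U X + (2^-1 * restr1 th H X) *: \1%VF); split; last first.
  by rewrite scaleNr addrC addrK.
move=> Y Z; rewrite !lfun_simp /restr2 /restr1 !linearD !linearZ /=.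
rewrite !val_ad_on //.
rewrite (two_formDl hom) (two_formDr hom) (two_formZl hom) (two_formZr hom).
apply/eqP; rewrite -addr_eq0 addrACA.
rewrite (abelian_ideal_homothety _ _ _ (subvsP Y) (subvsP Z)).
by rewrite -mulrDl -mulrDl -[2^-1]div1r -Num.Theory.splitr mul1r addNr.
Qed.

(** If X stabilizes om, [abelian_ideal_homothety] reads
th X * om(Y, Z) = 0 on U. So th X <> 0 would make om vanish on U, which
non-degeneracy forbids for U <> 0. *)
Lemma abelian_ideal_second_kind :
  U <> 0%VS -> nondegenerate_form (restr2 om U) -> second_kind om th.
Proof.
move=> U0 nd; split=> // X stX; apply/eqP/negPn/negP => thX.
apply: U0; apply/eqP; rewrite -subv0; apply/subvP => Y YU; rewrite memv0.
apply/eqP/(nondegenerate_restr_eq0 nd _ YU) => Z ZU.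
have := abelian_ideal_homothety X _ _ YU ZU; rewrite stX => /esym/eqP.
by rewrite oppr_eq0 mulf_eq0 (negPf thX) => /eqP.
Qed.

End LCS.

Theorem theorem3p6 (R : realType) (g : lieAlgType R)
    (om : g -> g -> R) (th : g -> R) (u : {vspace g})
    (hlcs : is_lcs om th) (hu : is_ideal u) (hu0 : u <> 0%VS)
    (hnd : nondegenerate_form (restr2 om u)) :
  ((perp om u + u)%VS = fullv /\ directv (perp om u + u)%VS) /\
  ((forall U, U \in u -> th U = 0) -> is_subalgebra (perp om u)) /\
  (forall hperp : is_subalgebra (perp om u),
     (forall U, U \in u -> th U = 0) -> is_abelian u ->
     let h : lieAlgType R := subalg_of hperp in
     let omh : h -> h -> R := restr2 om (perp om u) in
     let thh : h -> R := restr1 th (perp om u) in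
     let omu : subvs_of u -> subvs_of u -> R := restr2 om u in
     let ad : h -> 'End(subvs_of u) := ad_on hperp u in
     is_lcs omh thh /\
     is_symplectic_form omu /\
     is_lcs_representation thh omu ad /\
     (exists hpi : is_representation ad,
        let omt := semidirect_form hpi omh omu in
        let tht := semidirect_lee hpi thh in
        is_lcs omt tht /\ lcs_isomorphic om th omt tht) /\
     second_kind om th).
Proof.
have hom := lcs_form hlcs; have thl := lee_scalar hlcs.
have full := addv_perp hom hnd.
have direct : directv (perp om u + u)%VS.
  exact/directv_addP/(capv_perp hom hnd).
split=> //; split=> [thu|hperp thu uab h omh thh omu ad].
  exact: (perp_subalgebra hlcs hu thu).
have lcsh : is_lcs omh thh.
  exact/(is_lcs_restr hlcs)/(nondegenerate_perp hom hnd)/(lcs_nondeg hlcs).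
have lcsrep : is_lcs_representation thh omu ad.
  exact: (ad_on_lcs_representation hlcs hu thu uab).
split=> //; split; first by split=> //; exact: (is_two_form_restr hom).
split=> //; split; last exact: (abelian_ideal_second_kind hlcs thu uab hu0 hnd).
exists lcsrep.1 => omt tht.
have iso : lcs_isomorphic omt tht om th.
  apply: (semidirect_isomorphic hperp hu full direct uab _ hom thl _ thu).
  by move=> X Y /(mem_perp _ _ hom); apply.
by split; [exact: (lcs_isomorphic_lcs iso hlcs) | exact: lcs_isomorphic_sym].
Qed.
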